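(* Let $X_1,X_2,\dots$ be independent identically distributed real random variables with $\mathbf E X_1=0$ and $\mathbf E X_1^2=\sigma^2\in(0,\infty)$. Let $S(n)=X_1+\dots+X_n$ and $\tau_x=\inf\{n\ge1:\ x+S(n)\le0\}$ for $x\ge0$. Then the function $V(x)=-\mathbf E[S(\tau_x)]$ is harmonic for $S(n)$ killed at $\tau_x$, that is, $$\mathbf E\left[V(x+S(1));\ \tau_x>1\right]=V(x)\quad\text{for all }x>0 .$$
   Context: $\mathbf E[Z;A]=\mathbf E[Z\mathbf 1_A]$. Under the assumptions $\tau_x<\infty$ almost surely and $V(x)$ is finite for every $x\ge0$. *)

(* Defs.v *)
From mathcomp Require Import all_boot all_order all_algebra finmap.
From mathcomp Require Import all_classical all_reals all_analysis.
Set Implicit Arguments.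
Unset Strict Implicit.
Unset Printing Implicit Defensive.
Import Order.TTheory GRing.Theory Num.Theory.
Import numFieldNormedType.Exports.
Local Open Scope classical_set_scope.
Local Open Scope ring_scope.

Section random_walk.
Context d (T : measurableType d) (R : realType) (P : probability T R).

Definition mutually_independent (X : nat -> {RV P >-> R}) :=
  forall (J : {fset nat}) (A : nat -> set R),
    (forall i, i \in J -> measurable (A i)) ->
    P (\bigcap_(i in [set` J]) (X i @^-1` A i)) =
    (\prod_(i <- J) P (X i @^-1` A i))%E.

Definition identically_distributed (X : nat -> {RV P >-> R}) :=
  forall (i : nat) (A : set R), measurable A ->
    distribution P (X i) A = distribution P (X 0%N) A.

(* E[Z; A] = E[Z 1_A] for an extended-real Z; the library's expectation is
   restricted to real-valued functions. *)
Definition expectation_on (Z : T -> \bar R) (A : set T) : \bar R :=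
  (\int[P]_w (Z w * (\1_A w)%:E))%E.

(* The sequence is indexed from 0: X 0, X 1, ... are the increments
   X_1, X_2, ... of the walk. *)
Definition walk (X : nat -> {RV P >-> R}) (n : nat) (w : T) : R :=
  \sum_(i < n) X i w.

(* The infimum of the empty set is +oo. *)
Definition tau (X : nat -> {RV P >-> R}) (x : R) (w : T) : \bar R :=
  ereal_inf [set (n%:R)%:E | n in [set n | (1 <= n)%N /\ x + walk X n w <= 0]].

(* S(tau_x). Where tau_x = +oo (a null event for a centred walk with finite
   positive variance) this is walk X 0 w = 0. *)
Definition walk_at_tau (X : nat -> {RV P >-> R}) (x : R) (w : T) : R :=
  walk X (Num.truncn (fine (tau X x w))) w.

Definition V (X : nat -> {RV P >-> R}) (x : R) : \bar R :=
  (- 'E_P[walk_at_tau X x])%E.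

End random_walk.

(* Main.v *)
Require Import Defs.
From HB Require Import structures.
From mathcomp Require Import all_boot all_order all_algebra finmap.
From mathcomp Require Import all_classical all_reals all_analysis.
From mathcomp Require Import measurable_realfun lra ring.
Import Order.TTheory GRing.Theory Num.Theory.
Import numFieldNormedType.Exports.
Set Implicit Arguments.
Unset Strict Implicit.
Unset Printing Implicit Defensive.
Local Open Scope classical_set_scope.
Local Open Scope ring_scope.

(** The identity is the Markov property at time 1. Given X_1 = a, the walk
either stops at once with S(tau_x) = a, when x + a <= 0, or restarts as an
independent copy from x + a > 0, and then S(tau_x) = a + S'(tau'_{x+a}).
Integrating over a gives

  E[- S(tau_x)] + E X_1 = E[V(x + X_1); x + X_1 > 0],

and E X_1 = 0. Since - S(tau_x) >= 0, all these quantities make sense in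
[0, +oo]; the signed term X_1 is split into its positive and negative parts,
whose finite means cancel. Two facts carry the argument.

- The Markov property itself ([path_law_renewal]). The law nu of the sequence
  (X_1, X_2, ...) on sequence space and the law mu of X_1 satisfy
  int F dnu = int int F(a, s_1, s_2, ...) nu(ds) mu(da): both sides agree on
  cylinders by independence, hence everywhere because cylinders form a
  pi-system. The later arguments see independence through this equation alone.

- tau_x is finite almost surely ([stays_above_null]). This is where the mean
  and the variance enter: on {tau_x = +oo} the stopped walk is 0, and the
  restarting identity fails there. The proof bounds the running depth
  W_n = - min_{k <= n} S_k, which obeys Lindley's recursion
  W_{n+1} = max(0, W_n' - X_1) with W_n' the depth of the shifted walk,
  independent of X_1. Squaring gives E W_n^2 <= n sigma^2. On the other hand
  E W_{n+1} - E W_n = E (X_1 - W_n')^+ >= eps q, where q is the probability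
  that S_k >= eps for all k >= 1. Hence n eps q <= E W_n <= sigma sqrt n for
  every n, so q = 0 ([stays_above_pos_null]). If the walk stayed above
  some - y with positive probability, a few upward jumps in front of such a
  path would give a walk staying above a positive level, a contradiction
  ([stays_above_descend]). *)

(** * Path space and the law of an i.i.d. sequence *)

(** Indexing A by all of nat, and not by the ordinals below n, avoids dependent
indices when cylinders of different lengths are intersected. *)
Definition cylinder (R : realType) (n : nat) (A : nat -> set R) :
  set (nat -> R) := [set s | forall i, (i < n)%N -> A i (s i)].

Definition cylinders (R : realType) : set (set (nat -> R)) :=
  [set C | exists n, exists2 A : nat -> set R,
    (forall i, measurable (A i)) & C = cylinder n A].

Definition paths (R : realType) : measurableType _ :=
  g_sigma_algebraType (@cylinders R).

Lemma measurable_coord (R : realType) (i : nat) :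
  measurable_fun [set: paths R] (fun s : paths R => s i).
Proof.
move=> _ B mB; rewrite setTI; apply: sub_sigma_algebra.
exists i.+1, (fun j => if j == i then B else setT).
  by move=> j; case: ifP.
apply/seteqP; split => [s /= Bs j _|s /(_ i (ltnSn i)) /=].
  by case: eqP => [->|//].
by rewrite eqxx.
Qed.

Lemma measurable_cylinder (R : realType) n (A : nat -> set R) :
  (forall i, measurable (A i)) -> measurable (cylinder n A : set (paths R)).
Proof. by move=> mA; apply: sub_sigma_algebra; exists n, A. Qed.

Lemma measurable_paths (d : measure_display) (T : measurableType d)
    (R : realType) (f : T -> paths R) :
  (forall i, measurable_fun setT (fun w => f w i)) -> measurable_fun setT f.
Proof.
move=> mf; apply: (@measurability _ _ T (paths R) setT f (@cylinders R)) => //.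
move=> _ [_ [n [A mA ->]] <-]; rewrite setTI.
have -> : f @^-1` cylinder n A =
    \bigcap_(i in [set i | (i < n)%N]) ((fun w => f w i) @^-1` A i) by [].
apply: bigcap_measurableType => i _.
by rewrite -[X in measurable X]setTI; exact: mf.
Qed.

Lemma cylinders_setI (R : realType) : setI_closed (@cylinders R).
Proof.
move=> _ _ [n [A mA ->]] [m [B mB ->]].
exists (maxn n m), (fun i => (if (i < n)%N then A i else setT) `&`
  (if (i < m)%N then B i else setT)).
  by move=> i; apply: measurableI; case: ifP.
apply/seteqP; split => [s [/= sA sB] i _|s /= sAB].
  by split; case: ifP => // h; [exact: sA|exact: sB].
by split => i h; have := sAB i; rewrite leq_max h ?orbT => /(_ isT) [].
Qed.

(** Uncurried so that it can be composed with functions on a product space. *)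
Definition cons_path (R : realType) (p : R * paths R) : paths R :=
  fun n => if n is m.+1 then p.2 m else p.1.

Lemma measurable_cons_path (R : realType) :
  measurable_fun setT (@cons_path R).
Proof.
apply: measurable_paths => -[|i]; first exact: measurable_fst.
exact: (measurableT_comp (measurable_coord i) measurable_snd).
Qed.

(** The one-step Markov property in distribution: a nu-path is a mu-step
followed by an independent nu-path. For nu the law of an i.i.d. sequence this
is the fixed-point equation that characterizes nu. *)
Definition renewal_law (R : realType) (mu : probability R R)
    (nu : probability (paths R) R) : Prop :=
  forall F : paths R -> \bar R,
    measurable_fun setT F -> (forall s, 0 <= F s)%E ->
    (\int[nu]_s F s = \int[mu]_a \int[nu]_s F (cons_path (a, s)))%E.

Section sample_path.
Context d (T : measurableType d) (R : realType) (P : probability T R).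
Variable X : nat -> {RV P >-> R}.

Definition sample_path (w : T) : paths R := X ^~ w.

Lemma measurable_sample_path : measurable_fun setT sample_path.
Proof. by apply: measurable_paths => i. Qed.

HB.instance Definition _ :=
  @isMeasurableFun.Build _ _ _ _ _ measurable_sample_path.

Definition path_law : probability (paths R) R := distribution P sample_path.

Definition step_law : probability R R := distribution P (X 0%N).

End sample_path.

Section law.
Context d (T : measurableType d) (R : realType) (P : probability T R).
Variable X : nat -> {RV P >-> R}.
Hypothesis hindep : mutually_independent X.
Hypothesis hid : identically_distributed X.

Lemma path_law_cylinder n A : (forall i, measurable (A i)) ->
  path_law X (cylinder n A) = (\prod_(i < n) step_law X (A i))%E.
Proof.
move=> mA; change (P (sample_path X @^-1` cylinder n A) =
  \prod_(i < n) step_law X (A i))%E.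
pose J : {fset nat} := [fset i in iota 0 n]%fset.
have -> : sample_path X @^-1` cylinder n A =
    \bigcap_(i in [set` J]) (X i @^-1` A i).
  by apply/seteqP; split => w /= h i; have := h i; rewrite /= !inE /= mem_iota.
rewrite hindep//.
rewrite (perm_big (iota 0 n))/=; last first.
  by apply: uniq_perm; rewrite ?iota_uniq ?fset_uniq// => i; rewrite !inE.
rewrite -{1}(subn0 n) -/(index_iota 0 n) big_mkord; apply: eq_bigr => i _.
exact: hid.
Qed.

(** Both sides are probabilities on sequence space which take the product value
on cylinders, and the cylinders form a generating pi-system. *)
Lemma path_law_cons (A : set (paths R)) : measurable A ->
  path_law X A = (step_law X \x path_law X)%E (@cons_path R @^-1` A).
Proof.
move=> mA.
pose mc := isMeasurableFun.Build _ _ _ _ _ (@measurable_cons_path R).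
pose c : {mfun _ >-> _} := HB.pack (@cons_path R) mc.
have -> : (step_law X \x path_law X)%E (@cons_path R @^-1` A) =
   distribution (step_law X \x path_law X)%E c A by [].
apply: (@measure_unique _ R (paths R) (@cylinders R) (fun=> setT)) => //.
- exact: cylinders_setI.
- move=> _; exists 0%N, (fun=> setT) => //.
  by apply/seteqP; split.
- by rewrite bigcup_const.
- move=> _ [n [B mB ->]].
  etransitivity; first exact: path_law_cylinder.
  change (\prod_(i < n) step_law X (B i) =
    (step_law X \x path_law X) (@cons_path R @^-1` cylinder n B))%E.
  case: n => [|n].
    have -> : @cons_path R @^-1` cylinder 0 B = setT by apply/seteqP; split.
    rewrite big_ord0; apply/esym.
    exact: (probability_setT (step_law X \x path_law X)%E).
  have -> : @cons_path R @^-1` cylinder n.+1 B =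
      B 0%N `*` cylinder n (fun i => B i.+1).
    apply/seteqP; split => [[a s]/= h|[a s]/= [Ba h] [|i]//]; last exact: h.
    by split; [exact: (h 0%N)|move=> i ni; exact: (h i.+1)].
  rewrite product_measure1E//; last exact: measurable_cylinder.
  by rewrite big_ord_recl; congr (_ * _)%E; exact/esym/path_law_cylinder.
- by move=> _; rewrite -ge0_fin_numE// fin_num_measure.
Qed.

Lemma path_law_renewal : renewal_law (step_law X) (path_law X).
Proof.
move=> F mF F0.
pose mc := isMeasurableFun.Build _ _ _ _ _ (@measurable_cons_path R).
pose c : {mfun _ >-> _} := HB.pack (@cons_path R) mc.
have mFc : measurable_fun setT (F \o c) by exact: measurableT_comp.
rewrite -[RHS](fubini_tonelli1 (F \o c))//; last by move=> p; exact: F0.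
rewrite -(ge0_integral_distribution c)//.
by apply: eq_measure_integral => /= A mA _; rewrite path_law_cons.
Qed.

End law.

(** * Partial sums and the running depth *)

Section walk_on_paths.
Context (R : realType).
Implicit Types (a x y w : R) (s : paths R) (n : nat).

Definition shift_path s : paths R := fun n => s n.+1.

Lemma measurable_shift_path : measurable_fun setT shift_path.
Proof. by apply: measurable_paths => i; exact: measurable_coord. Qed.

Definition psum n s : R := \sum_(i < n) s i.

Lemma measurable_psum n : measurable_fun setT (psum n).
Proof. by apply: measurable_sum => i; exact: measurable_coord. Qed.

Lemma psum0 s : psum 0 s = 0.
Proof. by rewrite /psum big_ord0. Qed.

Lemma psumS n s : psum n.+1 s = s 0%N + psum n (shift_path s).
Proof. by rewrite /psum big_ord_recl. Qed.

Lemma psum_cons n a s : psum n.+1 (cons_path (a, s)) = a + psum n s.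
Proof. by rewrite psumS. Qed.

(** This is - min_{k <= n} S_k. Peeling off the first step, rather than the
last, makes the recursion compatible with the renewal equation: the depth on
the right is that of the shifted path, independent of the first step. *)
Fixpoint lindley n s : R :=
  if n is m.+1 then Num.max 0 (lindley m (shift_path s) - s 0%N) else 0.

Lemma lindley_ge0 n s : 0 <= lindley n s.
Proof. by case: n => //= n; rewrite le_max lexx. Qed.

Lemma measurable_lindley n : measurable_fun setT (lindley n).
Proof.
elim: n => [|n IH] /=; first exact: measurable_cst.
apply: measurable_maxr; first exact: measurable_cst.
apply: measurable_funB; last exact: measurable_coord.
exact: (measurableT_comp IH measurable_shift_path).
Qed.

(** One half of the identity lindley n s = - min_{k <= n} psum k s. *)
Lemma lindley_le n s b : 0 <= b -> (forall m, (m <= n)%N -> - b <= psum m s) ->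
  lindley n s <= b.
Proof.
elim: n s b => //= n IH s b b0 h; rewrite ge_max b0 /= lerBlDr.
have hs m : (m <= n)%N -> - (b + s 0%N) <= psum m (shift_path s).
  by move=> mn; have := h m.+1 mn; rewrite psumS; lra.
apply: IH hs; have := h 1%N isT; rewrite psumS psum0; lra.
Qed.

Definition stays_above y : set (paths R) :=
  [set s | forall n, (0 < n)%N -> y <= psum n s].

Lemma measurable_stays_above y : measurable (stays_above y).
Proof.
have -> : stays_above y =
    \bigcap_(n in [set n | (0 < n)%N]) (psum n @^-1` `[y, +oo[).
  by apply/seteqP; split => s h n /= n0;
    have := h n n0; rewrite /= in_itv/= andbT.
apply: bigcap_measurableType => n _; rewrite -[X in measurable X]setTI.
by apply: measurable_psum.
Qed.

End walk_on_paths.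

(** * Integrals of real functions against a probability *)

(** Signed integrands are handled by moving negative parts to the other side, so
that every integral has a nonnegative integrand, and cancelling them there
once their integrals are known to be finite. *)
Lemma adde_fin_inj (R : realType) (z x y : \bar R) :
  z \is a fin_num -> (x + z = y + z -> x = y)%E.
Proof. by move=> zfin /(congr1 (fun u => u - z)%E); rewrite !addeK. Qed.

Section integral_EFin.
Context d (T : measurableType d) (R : realType) (P : probability T R).
Local Open Scope ereal_scope.

Lemma ge0_integralD_real (f g : T -> R) :
  measurable_fun setT f -> measurable_fun setT g ->
  (forall x, (0 <= f x)%R) -> (forall x, (0 <= g x)%R) ->
  \int[P]_x (f x + g x)%:E = \int[P]_x (f x)%:E + \int[P]_x (g x)%:E.
Proof.
move=> mf mg f0 g0.
apply: (ge0_integralD P measurableT (f1 := EFin \o f) (f2 := EFin \o g)).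
- by move=> x _; rewrite lee_fin.
- exact/measurable_EFinP.
- by move=> x _; rewrite lee_fin.
- exact/measurable_EFinP.
Qed.

Lemma ge0_integralZ_real (k : R) (f : T -> R) :
  measurable_fun setT f -> (0 <= k)%R -> (forall x, (0 <= f x)%R) ->
  \int[P]_x (k * f x)%:E = k%:E * \int[P]_x (f x)%:E.
Proof.
move=> mf k0 f0.
apply: (ge0_integralZl_EFin P measurableT (f1 := EFin \o f)) => //.
- by move=> x _; rewrite lee_fin.
- exact/measurable_EFinP.
Qed.

Lemma integral_cst_real (k : R) : \int[P]_x k%:E = k%:E.
Proof. by rewrite integral_cst//= probability_setT mule1. Qed.

Lemma integral_indicT (A : set T) : measurable A ->
  \int[P]_x (\1_A x)%:E = P A.
Proof. by move=> mA; rewrite integral_indic// setIT. Qed.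

Lemma ge0_le_integral_real (f g : T -> R) :
  measurable_fun setT f -> measurable_fun setT g ->
  (forall x, (0 <= f x)%R) -> (forall x, (f x <= g x)%R) ->
  \int[P]_x (f x)%:E <= \int[P]_x (g x)%:E.
Proof.
move=> mf mg f0 fg; apply: ge0_le_integral => //.
- by move=> x _; rewrite lee_fin.
- exact/measurable_EFinP.
- exact/measurable_EFinP.
- by move=> x _; rewrite lee_fin.
Qed.

End integral_EFin.

(** * Almost sure finiteness of the passage time *)

Section recurrence.
Context (R : realType) (mu : probability R R) (nu : probability (paths R) R).
Hypothesis renewal : renewal_law mu nu.
Variables (m v : R).
Hypothesis mpos : (\int[mu]_a (Num.max a 0)%:E = m%:E)%E.
Hypothesis mneg : (\int[mu]_a (Num.max (- a) 0)%:E = m%:E)%E.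
Hypothesis mvar : (\int[mu]_a (a ^+ 2)%:E = v%:E)%E.

Lemma renewal_swap (F : paths R -> \bar R) :
  measurable_fun setT F -> (forall s, 0 <= F s)%E ->
  (\int[nu]_s F s = \int[nu]_s \int[mu]_a F (cons_path (a, s)))%E.
Proof.
move=> mF F0; rewrite renewal//.
apply: (fubini_tonelli (F \o @cons_path R)) => [|p]; last exact: F0.
exact: (measurableT_comp mF (@measurable_cons_path R)).
Qed.

Let measurable_pos : measurable_fun [set: R] (fun a : R => Num.max a 0).
Proof. exact: measurable_maxr. Qed.

Let measurable_neg : measurable_fun [set: R] (fun a : R => Num.max (- a) 0).
Proof. by apply: measurable_maxr => //; exact: measurable_funN. Qed.

Let measurable_subl (w : R) :
  measurable_fun [set: R] (fun a : R => Num.max 0 (w - a)).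
Proof. by apply: measurable_maxr => //; exact: measurable_funB. Qed.

Let measurable_subr (w : R) :
  measurable_fun [set: R] (fun a : R => Num.max 0 (a - w)).
Proof. by apply: measurable_maxr => //; exact: measurable_funB. Qed.

Let max0l_ge0 (z : R) : 0 <= Num.max 0 z.
Proof. by rewrite le_max lexx. Qed.

Let max0r_ge0 (z : R) : 0 <= Num.max z 0.
Proof. by rewrite le_max lexx orbT. Qed.

Let m_ge0 : 0 <= m.
Proof. by rewrite -lee_fin -mpos integral_ge0// => a _; rewrite lee_fin. Qed.

(** Integrates (w - a)^+ + a = w + (a - w)^+; the drift term a vanishes
because the positive and negative parts of a step have the same mean. *)
Lemma integral_max_subl w : 0 <= w ->
  (\int[mu]_a (Num.max 0 (w - a))%:E =
   w%:E + \int[mu]_a (Num.max 0 (a - w))%:E)%E.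
Proof.
move=> w0; apply: (@adde_fin_inj _ m%:E) => //.
rewrite -{1}mpos -mneg -(integral_cst_real mu w) -!ge0_integralD_real//;
  last 2 first.
- exact: measurable_funD.
- by move=> a; rewrite addr_ge0.
apply: eq_integral => a _; congr _%:E.
by rewrite /Num.max; case: ifP; case: ifP; case: ifP; case: ifP; lra.
Qed.

(** Since (w - a)^+ <= |w - a|, the left side is at most
E (w - a)^2 = w^2 + v; the cross term - 2 w a is split into its positive and
negative parts, which have equal integrals. *)
Lemma integral_sqr_max_subl w : 0 <= w ->
  (\int[mu]_a ((Num.max 0 (w - a)) ^+ 2)%:E <= (w ^+ 2 + v)%:E)%E.
Proof.
move=> w0; have w20 : 0 <= 2 * w by rewrite mulr_ge0.
rewrite -(@leeD2rE _ ((2 * w)%:E * m%:E)%E)//.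
rewrite EFinD -{1}mpos -mneg -mvar -(integral_cst_real mu (w ^+ 2)).
rewrite -!ge0_integralZ_real// -!ge0_integralD_real//.
- apply: ge0_le_integral_real => [|||a].
  + by apply: measurable_funD; [exact: measurable_funX|exact: measurable_funM].
  + by apply: measurable_funD; [exact: measurable_funD|exact: measurable_funM].
  + by move=> a; rewrite addr_ge0 ?sqr_ge0// mulr_ge0.
  + by rewrite /Num.max; case: ifP; case: ifP; case: ifP; nra.
- exact: measurable_funD.
- exact: measurable_funM.
- by move=> a; rewrite addr_ge0 ?sqr_ge0.
- by move=> a; rewrite mulr_ge0.
- by move=> _; exact: sqr_ge0.
- by move=> a; exact: sqr_ge0.
- exact: measurable_funX.
- exact: measurable_funM.
- by move=> a; exact: sqr_ge0.
- by move=> a; rewrite mulr_ge0.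
Qed.

Let v_ge0 : 0 <= v.
Proof.
by rewrite -lee_fin -mvar integral_ge0// => a _; rewrite lee_fin sqr_ge0.
Qed.

Lemma measurable_integral_cons (F : paths R -> \bar R) :
  measurable_fun setT F -> (forall s, 0 <= F s)%E ->
  measurable_fun setT (fun a => \int[nu]_s F (cons_path (a, s)))%E /\
  measurable_fun setT (fun s => \int[mu]_a F (cons_path (a, s)))%E.
Proof.
move=> mF F0; have mFc : measurable_fun setT (F \o @cons_path R).
  exact: (measurableT_comp mF (@measurable_cons_path R)).
have Fc0 p : (0 <= (F \o @cons_path R) p)%E by exact: F0.
split; first exact: (measurable_fun_fubini_tonelli_F (F \o @cons_path R)).
exact: (measurable_fun_fubini_tonelli_G (F \o @cons_path R)).
Qed.

(** Diffusive upper bound on the depth: each step adds at most v to the second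
moment. *)
Lemma lindley_second_moment n :
  (\int[nu]_s ((lindley n s) ^+ 2)%:E <= (n%:R * v)%:E)%E.
Proof.
elim: n => [|n IH].
  by rewrite mul0r /= integral_cst_real expr0n.
have mF : measurable_fun setT (fun s : paths R => ((lindley n.+1 s) ^+ 2)%:E).
  by apply/measurable_EFinP/measurable_funX; exact: measurable_lindley.
have F0 (s : paths R) : (0 <= ((lindley n.+1 s) ^+ 2)%:E)%E.
  by rewrite lee_fin sqr_ge0.
rewrite renewal_swap//.
apply: (@le_trans _ _ (\int[nu]_s ((lindley n s) ^+ 2 + v)%:E)%E).
  apply: ge0_le_integral => //.
  - by move=> s _; apply: integral_ge0.
  - by have [] := measurable_integral_cons mF F0.
  - apply/measurable_EFinP; apply: measurable_funD => //.
    by apply: measurable_funX; exact: measurable_lindley.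
  - by move=> s _; exact: integral_sqr_max_subl (lindley_ge0 n s).
rewrite ge0_integralD_real//; last 2 first.
- by apply: measurable_funX; exact: measurable_lindley.
- by move=> s; rewrite sqr_ge0.
rewrite integral_cst_real -natr1 mulrDl mul1r EFinD.
exact: leeD2r.
Qed.

(** The mean depth increases by E (X_1 - W_n')^+. If the walk stays above eps
from time 1 on, then X_1 - W_n' = min_{1 <= k <= n + 1} S_k >= eps, so the
increment is at least eps times the probability of that event, uniformly
in n. *)
Lemma lindley_mean_growth n eps : 0 <= eps ->
  (\int[nu]_s (lindley n s)%:E + eps%:E * nu (stays_above eps) <=
   \int[nu]_s (lindley n.+1 s)%:E)%E.
Proof.
move=> eps0.
pose f (s : paths R) : R := Num.max 0 (s 0%N - lindley n (shift_path s)).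
have mf : measurable_fun setT f.
  apply: measurable_maxr => //; apply: measurable_funB.
    exact: measurable_coord.
  exact: (measurableT_comp (measurable_lindley n) (@measurable_shift_path R)).
have mfE : measurable_fun setT (EFin \o f) by exact/measurable_EFinP.
have f0 s : (0 <= (EFin \o f) s)%E by rewrite lee_fin /f.
rewrite [leRHS]renewal_swap; last 2 first.
- by apply/measurable_EFinP; exact: measurable_lindley.
- by move=> s; rewrite lee_fin lindley_ge0.
rewrite [leRHS](eq_integral (fun s => (lindley n s)%:E +
    \int[mu]_a (EFin \o f) (cons_path (a, s)))%E); last first.
  by move=> s _; exact: integral_max_subl (lindley_ge0 n s).
rewrite ge0_integralD//; last 4 first.
- by move=> s _; rewrite lee_fin lindley_ge0.
- by apply/measurable_EFinP; exact: measurable_lindley.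
- by move=> s _; apply: integral_ge0.
- by have [] := measurable_integral_cons mfE f0.
apply: leeD2l; rewrite -renewal_swap//.
have mB := measurable_stays_above eps.
rewrite -(integral_indicT nu)// -ge0_integralZ_real//.
apply: ge0_le_integral_real => //.
- by apply: measurable_funM => //; apply: measurable_indic.
- by move=> s; rewrite mulr_ge0.
move=> s; rewrite indicE; case: (boolP (s \in _)) => [|_]; last first.
  by rewrite mulr0 /f.
rewrite inE => Bs; rewrite mulr1 /f le_max; apply/orP; right.
have := Bs 1%N isT; rewrite psumS psum0 addr0 => eps_s0.
rewrite lerBrDr -lerBrDl; apply: lindley_le; first by rewrite subr_ge0.
by move=> k _; have := Bs k.+1 isT; rewrite psumS; lra.
Qed.

(** A walk that stays above eps > 0 with probability q > 0 would have mean depth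
growing linearly in n, against the bound of order sqrt n that follows from the
second moment. *)
Lemma stays_above_pos_null eps : 0 < eps -> nu (stays_above eps) = 0%E.
Proof.
move=> eps0; pose q := fine (nu (stays_above eps)).
have qE : nu (stays_above eps) = q%:E.
  by rewrite fineK// fin_num_measure//; exact: measurable_stays_above.
have q0 : 0 <= q by rewrite -lee_fin -qE.
have growth n : ((n%:R * (eps * q))%:E <= \int[nu]_s (lindley n s)%:E)%E.
  elim: n => [|n IH]; first by rewrite mul0r /= integral_cst_real.
  apply: le_trans (lindley_mean_growth n (ltW eps0)).
  by rewrite qE -natr1 mulrDl mul1r EFinD -EFinM leeD2r.
(* Integrates 2 t W <= W^2 + t^2; t is free in place of a square root. *)
have bound n t : 0 <= t -> 2 * t * (n%:R * (eps * q)) <= n%:R * v + t ^+ 2.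
  move=> t0; rewrite -lee_fin.
  apply: (@le_trans _ _ (\int[nu]_s (2 * t * lindley n s)%:E)%E).
    rewrite ge0_integralZ_real//; last 3 first.
    - exact: measurable_lindley.
    - by rewrite mulr_ge0.
    - exact: lindley_ge0.
    by rewrite EFinM lee_wpmul2l// lee_fin mulr_ge0.
  rewrite EFinD; apply: (@le_trans _ _
      (\int[nu]_s ((lindley n s) ^+ 2 + t ^+ 2)%:E)%E).
    apply: ge0_le_integral_real => //.
    - by apply: measurable_funM => //; exact: measurable_lindley.
    - apply: measurable_funD => //.
      by apply: measurable_funX; exact: measurable_lindley.
    - by move=> s; rewrite !mulr_ge0// lindley_ge0.
    - by move=> s; have := sqr_ge0 (lindley n s - t); nra.
  rewrite ge0_integralD_real//; last 3 first.
  - by apply: measurable_funX; exact: measurable_lindley.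
  - by move=> s; rewrite sqr_ge0.
  - by move=> _; rewrite sqr_ge0.
  by rewrite integral_cst_real leeD2r// lindley_second_moment.
(* The choice t = n eps q in [bound] gives n (eps q)^2 <= v. *)
rewrite qE; congr _%:E; apply/eqP; rewrite eq_le q0 andbT leNgt.
apply/negP => qp.
have k0 : 0 < (eps * q) ^+ 2 by rewrite exprn_gt0// mulr_gt0.
pose n := (Num.truncn (v / (eps * q) ^+ 2)).+1.
have vn : v < n%:R * (eps * q) ^+ 2.
  by rewrite -ltr_pdivrMr// truncnS_gt.
have n0 : 0 < n%:R :> R by rewrite ltr0n.
have := bound n _ (mulr_ge0 (ltW n0) (mulr_ge0 (ltW eps0) q0)).
have : n%:R * v < n%:R * (n%:R * (eps * q) ^+ 2) by rewrite ltr_pM2l.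
nra.
Qed.

(** Prefixing a path that stays above - y with a step of size at least del
produces a path that stays above - y + del. At time 1 the step alone must clear
this level, whence the condition on y. *)
Lemma stays_above_descend y del : 0 <= y ->
  (mu `[del, +oo[%classic * nu (stays_above (- y)) <=
   nu (stays_above (- (y - del))))%E.
Proof.
move=> y0.
have mB z := @measurable_stays_above R z.
rewrite -[leRHS]integral_indicT//.
rewrite renewal; last 2 first.
- by apply/measurable_EFinP; exact: measurable_indic.
- by move=> s; rewrite lee_fin.
rewrite muleC -(integral_indicT mu)//.
rewrite -ge0_integralZl//; last first.
  by apply/measurable_EFinP; exact: measurable_indic.
have mI : measurable_fun setT (fun s : paths R =>
    (\1_(stays_above (- (y - del))) s : R)%:E).
  by apply/measurable_EFinP; exact: measurable_indic.
apply: ge0_le_integral => //.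
- by move=> a _; rewrite mule_ge0// lee_fin.
- apply: measurable_funeM; apply/measurable_EFinP; exact: measurable_indic.
- by have [] := measurable_integral_cons mI (fun s => _).
move=> a _; rewrite indicE; case: (boolP (a \in _)) => [|_]; last first.
  by rewrite mule0 integral_ge0.
rewrite inE /= in_itv/= andbT => dela; rewrite mule1.
rewrite -(integral_indicT nu)//.
apply: ge0_le_integral_real => //.
apply: (measurableT_comp (f := \1_(stays_above (- (y - del))) : paths R -> R)).
  exact: measurable_indic.
exact: (measurableT_comp (@measurable_cons_path R) (pair1_measurable a)).
move=> s; rewrite !indicE; case: (boolP (s \in _)) => // Bs.
rewrite mem_set//= => -[//|n] _; rewrite psum_cons.
case: n => [|n]; first by rewrite psum0; lra.
by move: Bs; rewrite inE => /(_ n.+1 isT); lra.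
Qed.

(** Upward jumps of size del lift any level - y to a positive one in finitely
many applications of [stays_above_descend], each at the cost of a positive
factor. *)
Lemma stays_above_null del : 0 < del -> (0 < mu `[del, +oo[%classic)%E ->
  forall y, nu (stays_above y) = 0%E.
Proof.
move=> del0 mudel.
have main n y : y < n%:R * del -> nu (stays_above (- y)) = 0%E.
  elim: n y => [|n IH] y.
    by rewrite mul0r -oppr_gt0; exact: stays_above_pos_null.
  rewrite -natr1 mulrDl mul1r => yn.
  have [y0|y0] := ltP y 0.
    by apply: stays_above_pos_null; rewrite oppr_gt0.
  have := stays_above_descend del y0.
  rewrite (IH (y - del)); last by rewrite ltrBlDr.
  move=> h; apply/eqP; rewrite eq_le measure_ge0 andbT.
  by rewrite -(@lee_pmul2l _ (mu `[del, +oo[%classic)) ?mule0// fin_num_measure.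
move=> y; rewrite -(opprK y); apply: (main (Num.truncn (- y / del)).+1).
by rewrite -ltr_pdivrMr// truncnS_gt.
Qed.

End recurrence.

(** * First passage of a path *)

Section first_passage.
Context (R : realType).
Implicit Types (a x y : R) (s : paths R) (n : nat).

(** Deterministic counterparts of the passage time and of the stopped walk, with
the same conventions when the level is never crossed; they turn into the random
ones by conversion when evaluated at a sample path. *)
Definition passage_time x s : \bar R :=
  ereal_inf [set (n%:R)%:E | n in [set n | (1 <= n)%N /\ x + psum n s <= 0]].

Definition passage_value x s : R :=
  psum (Num.truncn (fine (passage_time x s))) s.

Definition first_passage x n : set (paths R) :=
  [set s | [/\ (1 <= n)%N, x + psum n s <= 0 &
    forall k, (1 <= k < n)%N -> 0 < x + psum k s]].

Lemma passage_time_first x n s :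
  first_passage x n s -> passage_time x s = n%:R%:E.
Proof.
move=> [n1 hn hmin]; apply/eqP; rewrite eq_le; apply/andP; split.
  by apply: ereal_inf_lbound; exists n.
apply: le_ereal_inf_tmp => _ [k [k1 hk] <-]; rewrite lee_fin ler_nat leqNgt.
apply/negP => kn; have := hmin k; rewrite k1 kn => /(_ isT).
by rewrite ltNge hk.
Qed.

Lemma passage_value_first x n s :
  first_passage x n s -> passage_value x s = psum n s.
Proof. by move=> /passage_time_first h; rewrite /passage_value h /= natrK. Qed.

Lemma first_passage_dichotomy x s :
  (exists n, first_passage x n s) \/ (forall n, (0 < n)%N -> 0 < x + psum n s).
Proof.
have [hit|nohit] := pselect (exists n, (0 < n)%N && (x + psum n s <= 0)).
  left; case: (ex_minnP hit) => n /andP[n0 hn] nmin; exists n; split => // k.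
  move=> /andP[k1 kn]; rewrite ltNge; apply/negP => hk.
  by have := nmin k; rewrite k1 hk leqNgt kn => /(_ isT).
right => n n0; rewrite ltNge; apply/negP => hn.
by apply: nohit; exists n; rewrite n0.
Qed.

(** The infimum of the empty set is +oo, whose finite part is 0. *)
Lemma passage_value_stays x s :
  (forall n, (0 < n)%N -> 0 < x + psum n s) -> passage_value x s = 0.
Proof.
move=> h; rewrite /passage_value /passage_time.
rewrite (_ : [set n | _] = set0) ?image_set0 ?ereal_inf0/= ?truncn0 ?psum0//.
by apply/seteqP; split => // n [/h]; rewrite ltNge => /negP.
Qed.

Lemma passage_value_le0 x s : 0 <= x -> passage_value x s <= 0.
Proof.
move=> x0; have [[n hn]|h] := first_passage_dichotomy x s; last first.
  by rewrite passage_value_stays.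
by rewrite (passage_value_first hn); case: hn => _; lra.
Qed.

Lemma measurable_first_passage x n : measurable (first_passage x n).
Proof.
have mset k (A : set R) : measurable A -> measurable [set s | A (psum k s)].
  by move=> mA; rewrite -[X in measurable X]setTI; exact: measurable_psum.
have [->|n0] := posnP n.
  rewrite (_ : first_passage x 0 = set0)//.
  by apply/seteqP; split => // s [].
have -> : first_passage x n = [set s | `]-oo, - x]%classic (psum n s)] `&`
    \bigcap_(k in [set k | (1 <= k < n)%N])
      [set s | `]- x, +oo[%classic (psum k s)].
  apply/seteqP; split => s.
    move=> [_ h1 h2]; split => [|k hk] /=; rewrite in_itv/=; first lra.
    by have := h2 k hk; rewrite andbT; lra.
  move=> [/=]; rewrite in_itv/= => h1 h2; split => //; first lra.
  by move=> k hk; have := h2 k hk; rewrite /= in_itv/= andbT; lra.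
apply: measurableI; first exact: mset.
by apply: bigcap_measurableType => k _; exact: mset.
Qed.

Lemma measurable_passage_value x : measurable_fun setT (passage_value x).
Proof.
move=> _ A mA; rewrite setTI.
have -> : passage_value x @^-1` A =
    \bigcup_n (first_passage x n `&` psum n @^-1` A) `|`
    (~` (\bigcup_n first_passage x n) `&` [set _ | A 0]).
  apply/seteqP; split => s /=.
    have [[n hn]|h] := first_passage_dichotomy x s.
      by rewrite (passage_value_first hn) => As; left; exists n.
    rewrite passage_value_stays// => A0; right; split => // -[n _ [n1 hn _]].
    by have := h n n1; rewrite ltNge hn.
  move=> [[n _ [hn]]|[hN A0]]; first by rewrite /= (passage_value_first hn).
  have [[n hn]|h] := first_passage_dichotomy x s; last first.
    by rewrite passage_value_stays.
  by exfalso; apply: hN; exists n.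
apply: measurableU.
  apply: bigcup_measurable => n _; apply: measurableI.
    exact: measurable_first_passage.
  by rewrite -[X in measurable X]setTI; exact: measurable_psum.
apply: measurableI.
  apply: measurableC; apply: bigcup_measurable => n _.
  exact: measurable_first_passage.
have [A0|A0] := pselect (A 0).
  by rewrite (_ : [set _ | _] = setT)//; apply/seteqP; split.
by rewrite (_ : [set _ | _] = set0)//; apply/seteqP; split.
Qed.

Lemma passage_value_cons_stop x a s :
  x + a <= 0 -> passage_value x (cons_path (a, s)) = a.
Proof.
move=> xa; rewrite (@passage_value_first _ 1%N) ?psum_cons ?psum0 ?addr0//.
split => //; first by rewrite psum_cons psum0 addr0.
by move=> k /andP[k1]; rewrite ltnNge k1.
Qed.

(** The restart needs a finite passage time: on a path that never crosses the
level the stopped value is 0 on both sides and the first step a is lost. *)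
Lemma passage_value_cons_go x a s n : 0 < x + a -> first_passage (x + a) n s ->
  passage_value x (cons_path (a, s)) = a + passage_value (x + a) s.
Proof.
move=> xa hn; rewrite (passage_value_first hn); case: hn => n1 hn hmin.
rewrite (@passage_value_first _ n.+1) ?psum_cons//.
split => //; first by rewrite psum_cons addrA.
move=> [//|[|k]] hk; rewrite psum_cons; first by rewrite psum0 addr0.
by rewrite addrA; exact: hmin.
Qed.

Lemma passage_time_gt1 x s : (1 < passage_time x s)%E = (0 < x + s 0%N).
Proof.
have p1 : psum 1 s = s 0%N by rewrite psumS psum0 addr0.
apply/idP/idP => [h|h].
  rewrite ltNge; apply/negP => xs; move: h; rewrite ltNge => /negP; apply.
  by apply: ereal_inf_lbound; exists 1%N => //; split; rewrite // p1.
have [[n hn]|hs] := first_passage_dichotomy x s.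
  rewrite (passage_time_first hn) lte_fin ltr1n.
  case: hn => n1 hn _; move: n1 hn; case: n => [|[|n]]// _.
  by rewrite p1; lra.
rewrite /passage_time (_ : [set n | _] = set0) ?image_set0 ?ereal_inf0 ?ltry//.
by apply/seteqP; split => // n [/hs]; rewrite ltNge => /negP.
Qed.

End first_passage.

(** * Harmonicity *)

Section harmonicity.
Context (R : realType) (mu : probability R R) (nu : probability (paths R) R).
Hypothesis renewal : renewal_law mu nu.
Variables (m : R).
Hypothesis mpos : (\int[mu]_a (Num.max a 0)%:E = m%:E)%E.
Hypothesis mneg : (\int[mu]_a (Num.max (- a) 0)%:E = m%:E)%E.
Implicit Types (a x y : R) (s : paths R).
Hypothesis null : forall y, nu (stays_above y) = 0%E.

(** The function V, expressed through the law of the path alone. *)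
Definition mean_drop x : \bar R := (\int[nu]_s (- passage_value x s)%:E)%E.

Let measurable_loss x :
  measurable_fun setT (fun s : paths R => - passage_value x s).
Proof. by apply: measurable_funN; exact: measurable_passage_value. Qed.

Let loss_ge0 x (s : paths R) : 0 <= x -> 0 <= - passage_value x s.
Proof. by move=> x0; rewrite oppr_ge0 passage_value_le0. Qed.

Lemma mean_drop_ge0 x : 0 <= x -> (0 <= mean_drop x)%E.
Proof. by move=> x0; apply: integral_ge0 => s _; rewrite lee_fin loss_ge0. Qed.

(** Conditioning on the first step. In the stopping case the left side is
- a + a = 0; in the other case the path restarts from x + a, up to the null set
of paths that never cross the level. *)
Lemma one_step x a : 0 <= x ->
  (\int[nu]_s (- passage_value x (cons_path (a, s)))%:E + a%:E =
   mean_drop (x + a)%R * (0 < x + a)%R%:R%:E)%E.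
Proof.
move=> x0; have [xa|xa] := leP (x + a) 0.
  rewrite mule0 (eq_integral (fun=> (- a)%:E)); last first.
    by move=> s _; rewrite passage_value_cons_stop.
  by rewrite integral_cst_real -EFinD addNr.
rewrite mule1.
have mc : measurable_fun setT
    (fun s : paths R => - passage_value x (cons_path (a, s))).
  apply: (measurableT_comp (measurable_loss x)).
  exact: (measurableT_comp (@measurable_cons_path R) (pair1_measurable a)).
have h : (\int[nu]_s (- passage_value x (cons_path (a, s)))%:E +
    (Num.max a 0)%:E =
    mean_drop (x + a)%R + (Num.max (- a) 0)%:E)%E.
  rewrite -(integral_cst_real nu (Num.max a 0)).
  rewrite -(integral_cst_real nu (Num.max (- a) 0)).
  rewrite -!ge0_integralD_real//; last 4 first.
  - by move=> s; apply: loss_ge0; exact: ltW.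
  - by move=> s; rewrite le_max lexx orbT.
  - by move=> s; exact: loss_ge0.
  - by move=> s; rewrite le_max lexx orbT.
  apply: ae_eq_integral => //.
  - by apply/measurable_EFinP; apply: measurable_funD.
  - by apply/measurable_EFinP; apply: measurable_funD.
  exists (stays_above (- (x + a))); split.
  - exact: measurable_stays_above.
  - exact: null.
  move=> s /= hs n n0; have [[k hk]|hn] := first_passage_dichotomy (x + a) s.
    exfalso; apply: hs => _; rewrite (passage_value_cons_go xa hk); congr _%:E.
    by rewrite /Num.max; case: ifP; case: ifP; lra.
  by have := hn n n0; lra.
have -> : (a%:E = (Num.max a 0)%:E - (Num.max (- a) 0)%:E)%E.
  by rewrite -EFinB; congr _%:E; rewrite /Num.max; case: ifP; case: ifP; lra.
by rewrite addeA h addeK.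
Qed.

(** Measurability comes with the identity: by [one_step] the integrand is the
sum of a partial integral and of the identity function. *)
Lemma mean_drop_harmonic x : 0 <= x ->
  measurable_fun setT (fun a => mean_drop (x + a)%R * (0 < x + a)%R%:R%:E)%E /\
  (mean_drop x = \int[mu]_a (mean_drop (x + a)%R * (0 < x + a)%R%:R%:E))%E.
Proof.
move=> x0.
pose F (s : paths R) : \bar R := (- passage_value x s)%:E.
have mF : measurable_fun setT F by exact/measurable_EFinP.
have F0 s : (0 <= F s)%E by rewrite lee_fin loss_ge0.
have [mG _] := measurable_integral_cons mu nu mF F0.
pose K a : \bar R := (mean_drop (x + a)%R * (0 < x + a)%R%:R%:E)%E.
have KE a : K a = (\int[nu]_s F (cons_path (a, s)) + a%:E)%E.
  by rewrite /K -one_step.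
have mK : measurable_fun setT K.
  rewrite (_ : K = (fun a => \int[nu]_s F (cons_path (a, s)))%E \+ EFin)%E;
      last first.
    by apply/funext => a; exact: KE.
  by apply: emeasurable_funD => //; exact/measurable_EFinP.
have K0 a : (0 <= K a)%E.
  rewrite /K; have [xa|xa] := leP (x + a) 0; first by rewrite mule0.
  by rewrite mule1 mean_drop_ge0// ltW.
split=> //; apply: (@adde_fin_inj _ m%:E) => //.
rewrite [mean_drop x](renewal mF F0) -{1}mpos -mneg.
rewrite -ge0_integralD//; last 3 first.
- by move=> a _; apply: integral_ge0 => s _; exact: F0.
- by move=> a _; rewrite lee_fin le_max lexx orbT.
- by apply/measurable_EFinP; exact: measurable_maxr.
rewrite -ge0_integralD//; last 3 first.
- by move=> a _; exact: K0.
- by move=> a _; rewrite lee_fin le_max lexx orbT.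
- by apply/measurable_EFinP; apply: measurable_maxr => //;
  exact: measurable_funN.
apply: eq_integral => a _; rewrite -/(K a) KE.
have -> : (Num.max a 0)%:E = (a%:E + (Num.max (- a) 0)%:E :> \bar R)%E.
  by rewrite -EFinD; congr _%:E; rewrite /Num.max; case: ifP; case: ifP; lra.
by rewrite addeA.
Qed.

End harmonicity.

Section step_law_facts.
Context (R : realType) (mu : probability R R).

(** Without positive jumps the positive part would have mean zero, hence so
would the negative part, and the step would vanish almost surely. *)
Lemma exists_pos_jump (m : R) :
  (\int[mu]_a (Num.max a 0)%:E = m%:E)%E ->
  (\int[mu]_a (Num.max (- a) 0)%:E = m%:E)%E ->
  (\int[mu]_a (a ^+ 2)%:E != 0)%E ->
  exists2 del : R, 0 < del & (0 < mu `[del, +oo[%classic)%E.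
Proof.
move=> mpos mneg mvar.
have mM : measurable_fun [set: R] (fun a : R => (Num.max a 0)%:E).
  by apply/measurable_EFinP; exact: measurable_maxr.
have mN : measurable_fun [set: R] (fun a : R => (Num.max (- a) 0)%:E).
  by apply/measurable_EFinP; apply: measurable_maxr => //;
    exact: measurable_funN.
have m2 : measurable_fun [set: R] (fun a : R => (a ^+ 2)%:E).
  by apply/measurable_EFinP; exact: measurable_funX.
apply: contrapT => nodel.
have zero k : mu `[k.+1%:R^-1, +oo[%classic = 0%E.
  apply/eqP; rewrite eq_le measure_ge0 andbT leNgt; apply/negP => h.
  by apply: nodel; exists k.+1%:R^-1 => //; rewrite invr_gt0.
have ae_le0 : {ae mu, forall a, a <= 0}.
  have : mu.-negligible (\bigcup_k `[k.+1%:R^-1, +oo[%classic).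
    apply: negligible_bigcup => k; exists `[k.+1%:R^-1, +oo[%classic.
    by split => //; exact: zero.
  apply: negligibleS => a /= /negP; rewrite -ltNge => a0.
  exists (Num.truncn a^-1) => //=; rewrite in_itv/= andbT.
  by rewrite invf_ple ?posrE// ltW// truncnS_gt.
have m0 : m = 0.
  have : (\int[mu]_a (Num.max a 0)%:E = \int[mu]_a 0%:E)%E.
    apply: ae_eq_integral => //.
    by apply: filterS ae_le0 => a a0 _; congr _%:E; apply/max_idPr.
  by rewrite mpos integral_cst_real => -[].
have ae_ge0 : ae_eq mu setT (fun a : R => (Num.max (- a) 0)%:E) (cst 0%E).
  apply/ae_eq_integral_abs => //.
  transitivity (\int[mu]_a (Num.max (- a) 0)%:E)%E; last by rewrite mneg m0.
  apply: eq_integral => a _.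
  by rewrite gee0_abs// lee_fin le_max lexx orbT.
move/negP: mvar; apply; apply/eqP.
rewrite -[RHS](integral_cst_real mu 0); apply: ae_eq_integral => //.
apply: filterS2 ae_le0 ae_ge0 => a a0 /(_ I) [] /max_idPr h _; congr _%:E.
by rewrite (_ : a = 0) ?expr0n//; lra.
Qed.

End step_law_facts.

Theorem lemma6p3 (d : measure_display) (T : measurableType d) (R : realType)
    (P : probability T R) (X : nat -> {RV P >-> R}) (sigma : R)
    (hindep : mutually_independent X)
    (hid : identically_distributed X)
    (hsigma : 0 < sigma)
    (hmean : ('E_P[X 0%N] = 0)%E)
    (hvar : ('E_P[fun w => (X 0%N w ^+ 2)%R] = (sigma ^+ 2)%:E)%E) :
  forall x : R, 0 < x ->
    expectation_on P (fun w => V X (x + walk X 1 w))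
      [set w | (1%:E < tau X x w)%E] = V X x.
Proof.
have step_integral (f : R -> R) :
    measurable_fun setT f -> (forall a, 0 <= f a) ->
    (\int[step_law X]_a (f a)%:E = \int[P]_w (f (X 0%N w))%:E)%E.
  move=> mf f0; rewrite /step_law.
  rewrite (ge0_integral_distribution (X 0%N) (f := EFin \o f))//.
  exact/measurable_EFinP.
have mvar : (\int[step_law X]_a (a ^+ 2)%:E = (sigma ^+ 2)%:E)%E.
  rewrite step_integral; last 2 first.
  - exact: measurable_funX.
  - by move=> a; exact: sqr_ge0.
  by rewrite -hvar unlock.
have [m [mpos mneg]] : exists m : R,
    (\int[step_law X]_a (Num.max a 0)%:E = m%:E)%E /\
    (\int[step_law X]_a (Num.max (- a) 0)%:E = m%:E)%E.
  move: hmean; rewrite unlock integralE.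
  rewrite (eq_integral (fun w => (Num.max (X 0%N w) 0)%:E)); last first.
    by move=> w _; rewrite funeposE EFin_max.
  rewrite [X in (_ - X)%E](eq_integral
    (fun w => (Num.max (- X 0%N w) 0)%:E)); last first.
    by move=> w _; rewrite funenegE EFin_max.
  rewrite -(step_integral (fun a => Num.max a 0)); last 2 first.
  - exact: measurable_maxr.
  - by move=> a; rewrite le_max lexx orbT.
  rewrite -(step_integral (fun a => Num.max (- a) 0)); last 2 first.
  - by apply: measurable_maxr => //; exact: measurable_funN.
  - by move=> a; rewrite le_max lexx orbT.
  set A := (\int[_]_a _)%E; set B := (\int[_]_a _)%E => AB.
  have A0 : (0 <= A)%E.
    by apply: integral_ge0 => a _; rewrite lee_fin le_max lexx orbT.
  have B0 : (0 <= B)%E.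
    by apply: integral_ge0 => a _; rewrite lee_fin le_max lexx orbT.
  case: A B A0 B0 AB => [A| |] [B| |]//= _ _ [] /eqP.
  by rewrite subr_eq0 => /eqP ->; exists B.
have renewal := path_law_renewal hindep hid.
have [del del0 jump] : exists2 del : R, 0 < del &
    (0 < step_law X `[del, +oo[%classic)%E.
  by apply: exists_pos_jump mpos mneg _; rewrite mvar eqe sqrf_eq0 gt_eqF.
have null := stays_above_null renewal mpos mneg mvar del0 jump.
have VE y : 0 <= y -> V X y = mean_drop (path_law X) y.
  move=> y0; rewrite /V /mean_drop.
  rewrite (ge0_integral_distribution (sample_path X)
    (f := fun s => (- passage_value y s)%:E)); last 2 first.
  - by apply/measurable_EFinP/measurable_funN; exact: measurable_passage_value.
  - by move=> s; rewrite lee_fin oppr_ge0 passage_value_le0.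
  have -> : ('E_P[walk_at_tau X y] =
      - \int[P]_w (- passage_value y (sample_path X w))%:E)%E.
    rewrite unlock -integral_ge0N; last first.
      by move=> w _; rewrite lee_fin oppr_ge0 passage_value_le0.
    by apply: eq_integral => w _; rewrite EFinN oppeK.
  by rewrite oppeK.
move=> x x0.
rewrite (VE _ (ltW x0)).
have [mK ->] := mean_drop_harmonic renewal mpos mneg null (ltW x0).
rewrite (ge0_integral_distribution (X 0%N)); last 2 first.
- exact: mK.
- move=> a; have [xa|xa] := leP (x + a) 0; first by rewrite mule0.
  by rewrite mule1 mean_drop_ge0// ltW.
apply: eq_integral => w _.
have gt1 : (1 < tau X x w)%E = (0 < x + X 0%N w).
  exact: (passage_time_gt1 x (sample_path X w)).
rewrite /walk big_ord1 indicE /=.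
rewrite (_ : (w \in _) = (0 < x + X 0%N w)); last first.
  by rewrite -gt1; apply/idP/idP; rewrite inE.
have [xa|xa] := leP (x + X 0%N w) 0; first by rewrite !mule0.
by rewrite !mule1 VE// ltW.
Qed.
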